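(* Let $D_n^{M,1}$ be the modified Durrmeyer operator with $a_0(n)=2$ and $a_1(n)=-3$ for all $n$. Let $g\in C^2[0,1]$ and let $x\in[0,1]$ be fixed. Then $$\left|D_n^{M,1}(g;x)-g(x)-\frac12 D_n^{M,1}\left((t-x)^2;x\right)g''(x)\right|\le C\,\frac1n\,\omega\left(g'',\frac{1}{\sqrt n}\right),$$ where $C>0$ is a constant independent of $n$ and $x$.
   Context: For integers $n\ge 0$ and $k$, $p_{n,k}(x)=\binom{n}{k}x^k(1-x)^{n-k}$ for $0\le k\le n$, and $p_{n,k}(x)=0$ if $k<0$ or $k>n$. Put $a(x,n)=a_1(n)x+a_0(n)$ (here, $a(x,n)=2-3x$) and, for $n\ge 1$, $$p_{n,k}^{M,1}(x)=a(x,n)\,p_{n-1,k}(x)+a(1-x,n)\,p_{n-1,k-1}(x),\quad 0\le k\le n$$ (so $p_{n,0}^{M,1}(x)=a(x,n)(1-x)^{n-1}$ and $p_{n,n}^{M,1}(x)=a(1-x,n)x^{n-1}$). The operator $D_n^{M,1}$ is $$D_n^{M,1}(f;x)=(n+1)\sum_{k=0}^{n}p_{n,k}^{M,1}(x)\int_0^1 p_{n,k}(t)f(t)\,dt,\quad x\in[0,1].$$ $D_n^{M,1}((t-x)^2;x)$ means the operator applied to the function $t\mapsto(t-x)^2$ (with $x$ fixed), evaluated at $x$. $\omega(h,\delta)=\sup\{|h(u)-h(v)|:u,v\in[0,1],\ |u-v|\le\delta\}$ is the first order modulus of continuity. *)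

(* Defs.v *)
From Stdlib Require Import Reals ZArith Bool.
From Coquelicot Require Import Coquelicot.
Open Scope R_scope.

Definition unit_interval (x : R) : Prop := 0 <= x <= 1.

(* [Binomial.C] is the binomial coefficient; Coquelicot's [C] is the type of
   complex numbers. *)
Definition bernstein (n : nat) (k : Z) (x : R) : R :=
  if (0 <=? k)%Z && (k <=? Z.of_nat n)%Z then
    Binomial.C n (Z.to_nat k) * x ^ Z.to_nat k * (1 - x) ^ (n - Z.to_nat k)
  else 0.

Definition lin_coef (a1 a0 : nat -> R) (x : R) (n : nat) : R := a1 n * x + a0 n.

(* Meaningful only for 1 <= n, because of the truncated n - 1. *)
Definition bernsteinM1 (a1 a0 : nat -> R) (n : nat) (k : Z) (x : R) : R :=
  lin_coef a1 a0 x n * bernstein (n - 1) k x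
  + lin_coef a1 a0 (1 - x) n * bernstein (n - 1) (k - 1) x.

(* [sum_f_R0 u n] is the sum of u 0, ..., u n. *)
Definition durrmeyerM1 (a1 a0 : nat -> R) (n : nat) (f : R -> R) (x : R) : R :=
  (INR n + 1) *
  sum_f_R0 (fun k => bernsteinM1 a1 a0 n (Z.of_nat k) x
                     * RInt (fun t => bernstein n (Z.of_nat k) t * f t) 0 1) n.

(* [g] is in C^2[0,1] with first and second derivatives [g1] and [g2] on [0,1].
   [D_in] and [continue_in] take limits within [0,1], hence one-sided limits at
   the endpoints; values outside [0,1] are irrelevant. *)
Definition C2_unit_interval (g g1 g2 : R -> R) : Prop :=
  forall x, unit_interval x ->
    D_in g g1 unit_interval x /\
    D_in g1 g2 unit_interval x /\
    continue_in g2 unit_interval x.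

(* The supremum is finite when [h] is bounded on [0,1], in particular when [h]
   is continuous there; [real] sends an infinite supremum to 0. *)
Definition modulus_continuity (h : R -> R) (delta : R) : R :=
  real (Lub_Rbar (fun y => exists u v,
    unit_interval u /\ unit_interval v /\ Rabs (u - v) <= delta /\
    y = Rabs (h u - h v))).

(* Main.v *)
Require Import Defs.
From Stdlib Require Import Reals ZArith.
From Coquelicot Require Import Coquelicot.
From Stdlib Require Import Bool Lra Lia.
Open Scope R_scope.

(** The operator factors through two classical means.  Multiplying by [n + 1]
    turns the integral against [p_{n,k}] into the expectation of [f] under the
    Beta(k+1, n-k+1) law ([beta_mean]), and summing over [k] against [p_{n-1,k}]
    or [p_{n-1,k-1}] is the expectation, under the Binomial(n-1, x) law
    ([binomial_mean]), of the sequence of Beta means or of its shift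
    ([durrmeyerM1_split]).  Moments of both laws are explicit rational
    functions, so [D] can be computed exactly on polynomials of degree at most 4.

    With [a(x) = 2 - 3x] the operator fixes affine functions
    ([durrmeyerM1_affine]): the constants because [a(x) + a(1-x) = 1], and the
    identity because [(n-1) x + a(1-x) + 1 = (n+2) x].  Hence the left-hand side
    of the theorem is exactly [D] applied to the second order Taylor remainder
    of [g] at [x].  By two uses of the mean value theorem this remainder is at
    most [(t-x)^2] times the oscillation of [g''] around [x]
    ([taylor_remainder_bound]), and with [delta = 1 / sqrt n] that oscillation is at most
    [(1 + n (t-x)^2) omega(g'', delta)] ([modulus_continuity_quadratic]).

    [D] is not a positive operator, since [a] changes sign on [0,1]; but [|a|]
    is at most 2 there, so [|D|] is dominated by twice the positive operator
    with [a] replaced by 1 ([durrmeyerM1_abs_le]).  What is left is the estimate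
    that this positive operator maps [(t-x)^2 + n (t-x)^4] to at most [6 / n]
    ([second_fourth_moment_bound]). *)

(** * Bernstein polynomials *)

Lemma bernstein_nat (n k : nat) (x : R) : (k <= n)%nat ->
  bernstein n (Z.of_nat k) x = Binomial.C n k * x ^ k * (1 - x) ^ (n - k).
Proof.
  intros H; unfold bernstein; rewrite Nat2Z.id.
  destruct (Z.leb_spec 0 (Z.of_nat k)); destruct (Z.leb_spec (Z.of_nat k) (Z.of_nat n));
    simpl; try lia; reflexivity.
Qed.

Lemma bernstein_out (n : nat) (k : Z) (x : R) :
  (k < 0 \/ Z.of_nat n < k)%Z -> bernstein n k x = 0.
Proof.
  intros H; unfold bernstein.
  destruct (Z.leb_spec 0 k); destruct (Z.leb_spec k (Z.of_nat n));
    simpl; try lia; reflexivity.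
Qed.

Lemma binomial_pos (n k : nat) : 0 < Binomial.C n k.
Proof.
  unfold Binomial.C; apply Rdiv_lt_0_compat; [|apply Rmult_lt_0_compat];
    apply INR_fact_lt_0.
Qed.

Lemma bernstein_nonneg (n : nat) (k : Z) (x : R) :
  unit_interval x -> 0 <= bernstein n k x.
Proof.
  intros [H0 H1]; unfold bernstein; destruct (_ && _); [|lra].
  apply Rmult_le_pos; [apply Rmult_le_pos|]; try (apply pow_le; lra).
  apply Rlt_le, binomial_pos.
Qed.

Lemma continuous_bernstein (n : nat) (k : Z) (t : R) : continuous (bernstein n k) t.
Proof.
  apply (ex_derive_continuous (K := R_AbsRing) (V := R_NormedModule)).
  unfold bernstein; destruct (_ && _); auto_derive; auto.
Qed.

Lemma bernstein_pascal (n : nat) (k : nat) (x : R) :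
  bernstein (S n) (Z.of_nat k) x
  = (1 - x) * bernstein n (Z.of_nat k) x + x * bernstein n (Z.of_nat k - 1) x.
Proof.
  destruct k as [|k].
  - rewrite (bernstein_out n (Z.of_nat 0 - 1)), !bernstein_nat, !C_n_0 by lia.
    rewrite !Nat.sub_0_r; simpl; ring.
  - replace (Z.of_nat (S k) - 1)%Z with (Z.of_nat k) by lia.
    destruct (Nat.lt_total k n) as [H|[->|H]].
    + rewrite !bernstein_nat by lia.
      rewrite <- (pascal n k) by lia.
      replace (S n - S k)%nat with (S (n - S k)) by lia.
      replace (n - k)%nat with (S (n - S k)) by lia.
      simpl; ring.
    + rewrite (bernstein_out n (Z.of_nat (S n))), !bernstein_nat, !C_n_n by lia.
      rewrite !Nat.sub_diag; simpl; ring.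
    + rewrite !bernstein_out by lia; ring.
Qed.

(** * Means under the binomial law *)

Definition binomial_mean (n : nat) (x : R) (F : nat -> R) : R :=
  sum_f_R0 (fun k => bernstein n (Z.of_nat k) x * F k) n.

Lemma sum_bernstein_S (n : nat) (x : R) (F : nat -> R) :
  sum_f_R0 (fun k => bernstein n (Z.of_nat k) x * F k) (S n) = binomial_mean n x F.
Proof.
  rewrite tech5, bernstein_out by lia; unfold binomial_mean; ring.
Qed.

Lemma sum_bernstein_shift (n : nat) (x : R) (F : nat -> R) :
  sum_f_R0 (fun k => bernstein n (Z.of_nat k - 1) x * F k) (S n)
  = binomial_mean n x (fun k => F (S k)).
Proof.
  rewrite decomp_sum, bernstein_out by lia; simpl pred; unfold binomial_mean.
  rewrite Rmult_0_l, Rplus_0_l; apply sum_eq; intros k _.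
  do 2 f_equal; lia.
Qed.

Lemma sum_linear (A B : nat -> R) (a b : R) (n : nat) :
  sum_f_R0 (fun k => a * A k + b * B k) n = a * sum_f_R0 A n + b * sum_f_R0 B n.
Proof. induction n as [|n IH]; simpl; [|rewrite IH]; ring. Qed.

(** Conditioning on one of the [n + 1] Bernoulli trials.  This recursion in [n]
    is what makes moments provable by induction without manipulating binomial
    coefficients. *)
Lemma binomial_mean_succ (n : nat) (x : R) (F : nat -> R) :
  binomial_mean (S n) x F
  = (1 - x) * binomial_mean n x F + x * binomial_mean n x (fun k => F (S k)).
Proof.
  rewrite <- (sum_bernstein_S n), <- (sum_bernstein_shift n), <- sum_linear; unfold binomial_mean.
  apply sum_eq; intros k _; rewrite bernstein_pascal; ring.
Qed.

Lemma binomial_mean_ext (n : nat) (x : R) (F G : nat -> R) :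
  (forall k, (k <= n)%nat -> F k = G k) -> binomial_mean n x F = binomial_mean n x G.
Proof. intros H; apply sum_eq; intros k Hk; rewrite H; auto. Qed.

Lemma binomial_mean_linear (n : nat) (x a b : R) (F G : nat -> R) :
  binomial_mean n x (fun k => a * F k + b * G k)
  = a * binomial_mean n x F + b * binomial_mean n x G.
Proof.
  unfold binomial_mean; rewrite <- sum_linear.
  apply sum_eq; intros k _; ring.
Qed.

Lemma binomial_mean_abs_le (n : nat) (x : R) (F G : nat -> R) :
  unit_interval x -> (forall k, (k <= n)%nat -> Rabs (F k) <= G k) ->
  Rabs (binomial_mean n x F) <= binomial_mean n x G.
Proof.
  intros Hx H; eapply Rle_trans; [apply Rsum_abs|].
  apply sum_Rle; intros k Hk; cbv beta.
  pose proof (bernstein_nonneg n (Z.of_nat k) x Hx).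
  rewrite Rabs_mult, (Rabs_pos_eq (bernstein _ _ _)) by assumption.
  apply Rmult_le_compat_l; auto.
Qed.

(** The coefficients [1; 1 1; 1 3 1; 1 7 6 1] are Stirling numbers of the second
    kind, and the other factors are the falling-factorial moments
    [n (n-1) ... (n-i+1) x^i]; all [c_i] vary in the induction because shifting [k]
    mixes the coefficients of the polynomial. *)
Lemma binomial_mean_quartic (n : nat) (x c0 c1 c2 c3 c4 : R) :
  binomial_mean n x (fun k => c0 + c1 * INR k + c2 * INR k ^ 2 + c3 * INR k ^ 3 + c4 * INR k ^ 4)
  = c0 + (c1 + c2 + c3 + c4) * (INR n * x)
    + (c2 + 3 * c3 + 7 * c4) * (INR n * (INR n - 1) * x ^ 2)
    + (c3 + 6 * c4) * (INR n * (INR n - 1) * (INR n - 2) * x ^ 3)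
    + c4 * (INR n * (INR n - 1) * (INR n - 2) * (INR n - 3) * x ^ 4).
Proof.
  revert c0 c1 c2 c3 c4; induction n as [|n IH]; intros.
  - unfold binomial_mean; simpl sum_f_R0.
    change 0%Z with (Z.of_nat 0); rewrite bernstein_nat, C_n_0 by lia; simpl; ring.
  - rewrite binomial_mean_succ, IH.
    rewrite (binomial_mean_ext _ _ _ (fun k => (c0 + c1 + c2 + c3 + c4)
      + (c1 + 2 * c2 + 3 * c3 + 4 * c4) * INR k + (c2 + 3 * c3 + 6 * c4) * INR k ^ 2
      + (c3 + 4 * c4) * INR k ^ 3 + c4 * INR k ^ 4)).
    2: intros k _; rewrite S_INR; ring.
    rewrite IH, S_INR; ring.
Qed.

(** * Means under the beta law *)

(** The expectation of [f] under the Beta(k+1, n-k+1) law when [k <= n]. *)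
Definition beta_mean (n : nat) (f : R -> R) (k : nat) : R :=
  (INR n + 1) * RInt (fun t => bernstein n (Z.of_nat k) t * f t) 0 1.

Lemma ex_RInt_bernstein (n k : nat) (f : R -> R) : (forall t, continuous f t) ->
  ex_RInt (fun t => bernstein n (Z.of_nat k) t * f t) 0 1.
Proof.
  intros Hf; apply (ex_RInt_continuous (V := R_CompleteNormedModule)); intros t _.
  apply (continuous_mult (K := R_AbsRing)); [apply continuous_bernstein | apply Hf].
Qed.

Lemma beta_mean_ext (n k : nat) (f h : R -> R) :
  (forall t, 0 < t < 1 -> f t = h t) -> beta_mean n f k = beta_mean n h k.
Proof.
  intros H; unfold beta_mean; f_equal; apply RInt_ext; intros t.
  rewrite Rmin_left, Rmax_right by lra; intros Ht; rewrite H; auto.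
Qed.

Lemma beta_mean_linear (n k : nat) (c : R) (f h : R -> R) :
  (forall t, continuous f t) -> (forall t, continuous h t) ->
  beta_mean n (fun t => f t + c * h t) k = beta_mean n f k + c * beta_mean n h k.
Proof.
  intros Hf Hh; unfold beta_mean.
  pose proof (ex_RInt_bernstein n k f Hf) as If.
  pose proof (ex_RInt_bernstein n k h Hh) as Ih.
  transitivity ((INR n + 1) * (RInt (fun t => bernstein n (Z.of_nat k) t * f t) 0 1
    + c * RInt (fun t => bernstein n (Z.of_nat k) t * h t) 0 1)); [|ring].
  f_equal; apply (is_RInt_unique (V := R_CompleteNormedModule)).
  apply (is_RInt_ext (V := R_NormedModule)
    (fun t => plus (bernstein n (Z.of_nat k) t * f t)
                   (scal c (bernstein n (Z.of_nat k) t * h t)))).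
  - intros t _; unfold plus, scal; simpl; unfold mult; simpl; ring.
  - apply (is_RInt_plus (V := R_NormedModule)); [|apply (is_RInt_scal (V := R_NormedModule))];
      apply (RInt_correct (V := R_CompleteNormedModule)); assumption.
Qed.

Lemma beta_mean_scal (n k : nat) (c : R) (f : R -> R) : (forall t, continuous f t) ->
  beta_mean n (fun t => c * f t) k = c * beta_mean n f k.
Proof.
  intros Hf; rewrite (beta_mean_ext _ _ _ (fun t => f t + (c - 1) * f t)) by (intros; ring).
  rewrite beta_mean_linear by assumption; ring.
Qed.

Lemma beta_mean_abs_le (n k : nat) (f h : R -> R) :
  (forall t, continuous f t) -> (forall t, continuous h t) ->
  (forall t, unit_interval t -> Rabs (f t) <= h t) ->
  Rabs (beta_mean n f k) <= beta_mean n h k.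
Proof.
  intros Hf Hh H; unfold beta_mean.
  pose proof (pos_INR n).
  rewrite Rabs_mult, (Rabs_pos_eq (INR n + 1)) by lra.
  apply Rmult_le_compat_l; [lra|].
  pose proof (ex_RInt_bernstein n k f Hf) as If.
  eapply Rle_trans; [apply abs_RInt_le; auto; lra|].
  apply RInt_le; [lra| | apply ex_RInt_bernstein; auto |].
  - apply (ex_RInt_continuous (V := R_CompleteNormedModule)); intros t _.
    apply (continuous_comp (fun t => bernstein n (Z.of_nat k) t * f t) Rabs).
    + apply (continuous_mult (K := R_AbsRing)); [apply continuous_bernstein | apply Hf].
    + apply continuous_Rabs.
  - intros t Ht.
    assert (Ht' : unit_interval t) by (unfold unit_interval; lra).
    pose proof (bernstein_nonneg n (Z.of_nat k) t Ht').
    rewrite Rabs_mult, (Rabs_pos_eq (bernstein _ _ _)) by assumption.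
    apply Rmult_le_compat_l; auto.
Qed.

Lemma RInt_derive_eq_ends (phi dphi : R -> R) :
  (forall t, is_derive phi t (dphi t)) -> (forall t, continuous dphi t) ->
  phi 0 = phi 1 -> RInt dphi 0 1 = 0.
Proof.
  intros H1 H2 H3.
  apply (is_RInt_unique (V := R_CompleteNormedModule)).
  replace 0 with (minus (phi 1) (phi 0)) at 2.
  - apply (is_RInt_derive (V := R_CompleteNormedModule)); auto.
  - rewrite H3; unfold minus, plus, opp; simpl; ring.
Qed.

Lemma continuous_pow (i : nat) (t : R) : continuous (fun t => t ^ i) t.
Proof.
  apply (ex_derive_continuous (K := R_AbsRing) (V := R_NormedModule)); auto_derive; auto.
Qed.

(** [p_{n,k} - p_{n,k+1}] is, up to a constant, the derivative of
    [p_{n+1,k+1}], which vanishes at both ends of [0,1]. *)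
Lemma RInt_bernstein_succ (n k : nat) : (k < n)%nat ->
  RInt (bernstein n (Z.of_nat (S k))) 0 1 = RInt (bernstein n (Z.of_nat k)) 0 1.
Proof.
  intros Hk.
  assert (Hi : forall j, ex_RInt (bernstein n j) 0 1).
  { intros j; apply (ex_RInt_continuous (V := R_CompleteNormedModule)); intros t _.
    apply continuous_bernstein. }
  apply Rminus_diag_uniq_sym.
  change (minus (RInt (bernstein n (Z.of_nat k)) 0 1)
                (RInt (bernstein n (Z.of_nat (S k))) 0 1) = 0).
  rewrite <- (RInt_minus (V := R_CompleteNormedModule)) by apply Hi.
  apply (RInt_derive_eq_ends
    (fun t => Binomial.C n k / INR (S k) * (t ^ S k * (1 - t) ^ (n - k)))).
  - intros t; cbv beta.
    match goal with |- is_derive _ _ ?d => replace d with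
      (Binomial.C n k / INR (S k) * (INR (S k) * t ^ k * (1 - t) ^ (n - k)
         - INR (n - k) * t ^ S k * (1 - t) ^ (n - S k))) end.
    + auto_derive; [trivial|].
      change (match k with 0%nat => 1 | S _ => INR k + 1 end) with (INR (S k)).
      replace (Nat.pred (n - k)) with (n - S k)%nat by lia.
      rewrite <- tech_pow_Rmult; unfold Rminus; ring.
    + change (minus (bernstein n (Z.of_nat k) t) (bernstein n (Z.of_nat (S k)) t))
        with (bernstein n (Z.of_nat k) t - bernstein n (Z.of_nat (S k)) t).
      rewrite !bernstein_nat, pascal_step3 by lia.
      field; apply not_0_INR; lia.
  - intros t; apply (continuous_minus (V := R_NormedModule)); apply continuous_bernstein.
  - replace (n - k)%nat with (S (n - S k)) by lia; simpl; ring.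
Qed.

Lemma RInt_bernstein (n k : nat) : (k <= n)%nat ->
  RInt (bernstein n (Z.of_nat k)) 0 1 = / (INR n + 1).
Proof.
  pose proof (pos_INR n) as Hn.
  induction k as [|k IH]; intros Hk.
  2: rewrite RInt_bernstein_succ by lia; apply IH; lia.
  apply (is_RInt_unique (V := R_CompleteNormedModule)).
  replace (/ (INR n + 1)) with
    (minus (- / (INR n + 1) * (1 - 1) ^ S n) (- / (INR n + 1) * (1 - 0) ^ S n)).
  2: { rewrite Rminus_0_r, pow1; unfold minus, plus, opp; simpl; ring. }
  apply (is_RInt_derive (V := R_CompleteNormedModule)
           (fun t => - / (INR n + 1) * (1 - t) ^ S n)).
  - intros t _; rewrite bernstein_nat, C_n_0, Nat.sub_0_r by lia.
    auto_derive; [trivial|].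
    change (match n with 0%nat => 1 | S _ => INR n + 1 end) with (INR (S n)).
    rewrite S_INR; simpl; unfold Rminus; field; lra.
  - intros t _; apply continuous_bernstein.
Qed.

Lemma beta_mean_one (n k : nat) : (k <= n)%nat -> beta_mean n (fun t => t ^ 0) k = 1.
Proof.
  intros Hk; unfold beta_mean; rewrite (RInt_ext _ (bernstein n (Z.of_nat k))).
  - rewrite RInt_bernstein by assumption; pose proof (pos_INR n); field; lra.
  - intros t _; simpl; ring.
Qed.

(** Integration by parts: the derivative of [t^(k+i+1) (1-t)^(n-k+1)], which
    vanishes at both ends, is
    [t^(k+i) (1-t)^(n-k) ((k+i+1) - (n+i+2) t)]. *)
Lemma beta_mean_pow_succ (n k i : nat) : (k <= n)%nat ->
  beta_mean n (fun t => t ^ S i) k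
  = (INR k + INR i + 1) / (INR n + INR i + 2) * beta_mean n (fun t => t ^ i) k.
Proof.
  intros Hk; pose proof (pos_INR n); pose proof (pos_INR i).
  set (c := - ((INR n + INR i + 2) / (INR k + INR i + 1))).
  pose proof (pos_INR k).
  enough (E : beta_mean n (fun t => t ^ i + c * t ^ S i) k = 0).
  { rewrite beta_mean_linear in E by apply continuous_pow.
    replace (beta_mean n (fun t => t ^ i) k)
      with (- (c * beta_mean n (fun t => t ^ S i) k)) by lra.
    unfold c; field; lra. }
  unfold beta_mean; apply Rmult_eq_0_compat_l.
  apply (RInt_derive_eq_ends (fun t => Binomial.C n k / (INR k + INR i + 1)
    * (t ^ S (k + i) * (1 - t) ^ S (n - k)))).
  - intros t; rewrite bernstein_nat by assumption.
    auto_derive; [trivial|].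
    change (match (n - k)%nat with 0%nat => 1 | S _ => INR (n - k) + 1 end)
      with (INR (S (n - k))).
    change (match (k + i)%nat with 0%nat => 1 | S _ => INR (k + i) + 1 end)
      with (INR (S (k + i))).
    rewrite !S_INR, plus_INR, minus_INR, pow_add by assumption.
    simpl; unfold c, Rminus; field; lra.
  - intros t; apply (continuous_mult (K := R_AbsRing)).
    + apply continuous_bernstein.
    + apply (ex_derive_continuous (K := R_AbsRing) (V := R_NormedModule)); auto_derive; auto.
  - simpl; ring.
Qed.

Lemma beta_mean_quartic (n k : nat) (c0 c1 c2 c3 c4 : R) : (k <= n)%nat ->
  beta_mean n (fun t => c0 + c1 * t + c2 * t ^ 2 + c3 * t ^ 3 + c4 * t ^ 4) k
  = let m := INR n in let j := INR k in
    c0 + c1 * ((j + 1) / (m + 2)) + c2 * ((j + 1) * (j + 2) / ((m + 2) * (m + 3)))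
    + c3 * ((j + 1) * (j + 2) * (j + 3) / ((m + 2) * (m + 3) * (m + 4)))
    + c4 * ((j + 1) * (j + 2) * (j + 3) * (j + 4)
            / ((m + 2) * (m + 3) * (m + 4) * (m + 5))).
Proof.
  intros Hk; pose proof (pos_INR n).
  rewrite (beta_mean_ext _ _ _
    (fun t => c0 * t ^ 0 + c1 * t ^ 1 + c2 * t ^ 2 + c3 * t ^ 3 + c4 * t ^ 4))
    by (intros; simpl; ring).
  rewrite !beta_mean_linear, beta_mean_scal by (first [apply continuous_pow | intros t;
    apply (ex_derive_continuous (K := R_AbsRing) (V := R_NormedModule)); auto_derive; auto]).
  rewrite !beta_mean_pow_succ, beta_mean_one by assumption.
  simpl INR; cbv zeta; field; lra.
Qed.

(** * The modified Durrmeyer operator *)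

Lemma durrmeyerM1_split (a1 a0 : nat -> R) (N : nat) (f : R -> R) (x : R) :
  durrmeyerM1 a1 a0 (S N) f x
  = lin_coef a1 a0 x (S N) * binomial_mean N x (beta_mean (S N) f)
    + lin_coef a1 a0 (1 - x) (S N) * binomial_mean N x (fun k => beta_mean (S N) f (S k)).
Proof.
  unfold durrmeyerM1.
  rewrite <- (sum_bernstein_S N), <- (sum_bernstein_shift N), <- sum_linear, scal_sum.
  apply sum_eq; intros k _.
  unfold bernsteinM1, beta_mean; rewrite Nat.sub_succ, Nat.sub_0_r; ring.
Qed.

Lemma durrmeyerM1_ext (a1 a0 : nat -> R) (n : nat) (f h : R -> R) (x : R) :
  (forall t, 0 < t < 1 -> f t = h t) ->
  durrmeyerM1 a1 a0 n f x = durrmeyerM1 a1 a0 n h x.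
Proof.
  intros H; unfold durrmeyerM1; f_equal; apply sum_eq; intros k _; f_equal.
  apply RInt_ext; intros t; rewrite Rmin_left, Rmax_right by lra; intros Ht.
  rewrite H; auto.
Qed.

Lemma durrmeyerM1_linear (a1 a0 : nat -> R) (N : nat) (c x : R) (f h : R -> R) :
  (forall t, continuous f t) -> (forall t, continuous h t) ->
  durrmeyerM1 a1 a0 (S N) (fun t => f t + c * h t) x
  = durrmeyerM1 a1 a0 (S N) f x + c * durrmeyerM1 a1 a0 (S N) h x.
Proof.
  intros Hf Hh; rewrite !durrmeyerM1_split.
  rewrite (binomial_mean_ext N x (beta_mean (S N) (fun t => f t + c * h t))
    (fun k => 1 * beta_mean (S N) f k + c * beta_mean (S N) h k))
    by (intros; rewrite beta_mean_linear by assumption; ring).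
  rewrite (binomial_mean_ext N x (fun k => beta_mean (S N) (fun t => f t + c * h t) (S k))
    (fun k => 1 * beta_mean (S N) f (S k) + c * beta_mean (S N) h (S k)))
    by (intros; rewrite beta_mean_linear by assumption; ring).
  rewrite !binomial_mean_linear; ring.
Qed.

(** Both Beta means of an affine function are affine in [k] with slope
    [c1 / (n+2)]; averaging them with weights [2 - 3x] and [3x - 1] produces
    [((n-1) x + 1 + (3x - 1)) / (n+2) = x]. *)
Lemma durrmeyerM1_affine (N : nat) (x c0 c1 : R) :
  durrmeyerM1 (fun _ => -3) (fun _ => 2) (S N) (fun t => c0 + c1 * t) x = c0 + c1 * x.
Proof.
  rewrite (durrmeyerM1_ext _ _ _ _ (fun t => c0 + c1 * t + 0 * t ^ 2 + 0 * t ^ 3 + 0 * t ^ 4))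
    by (intros; ring).
  rewrite durrmeyerM1_split.
  pose proof (pos_INR N).
  set (m := INR N + 3).
  rewrite (binomial_mean_ext N x _ (fun k => (c0 + c1 / m) + c1 / m * INR k
    + 0 * INR k ^ 2 + 0 * INR k ^ 3 + 0 * INR k ^ 4)).
  2: { intros k Hk; rewrite beta_mean_quartic by lia; cbv zeta; unfold m.
    rewrite S_INR; field; lra. }
  rewrite (binomial_mean_ext N x (fun k => beta_mean _ _ (S k))
   (fun k => (c0 + 2 * c1 / m) + c1 / m * INR k
    + 0 * INR k ^ 2 + 0 * INR k ^ 3 + 0 * INR k ^ 4)).
  2: { intros k Hk; rewrite beta_mean_quartic by lia; cbv zeta; unfold m.
    rewrite !S_INR; field; lra. }
  rewrite !binomial_mean_quartic; unfold lin_coef, m; field; lra.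
Qed.

(** The sum of binomial means on the right is the positive operator obtained
    by replacing both linear coefficients by 1. *)
Lemma durrmeyerM1_abs_le (a1 a0 : nat -> R) (A M : R) (N : nat) (x : R) (f h : R -> R) :
  unit_interval x -> 0 <= M ->
  Rabs (lin_coef a1 a0 x (S N)) <= A -> Rabs (lin_coef a1 a0 (1 - x) (S N)) <= A ->
  (forall t, continuous f t) -> (forall t, continuous h t) ->
  (forall t, unit_interval t -> Rabs (f t) <= M * h t) ->
  Rabs (durrmeyerM1 a1 a0 (S N) f x)
  <= A * M * (binomial_mean N x (beta_mean (S N) h)
              + binomial_mean N x (fun k => beta_mean (S N) h (S k))).
Proof.
  intros Hx HM HA HA' Hf Hh Hb; rewrite durrmeyerM1_split.
  assert (Hk : forall k, Rabs (beta_mean (S N) f k) <= 0 * beta_mean (S N) h k + M * beta_mean (S N) h k).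
  { intros k; replace (0 * beta_mean (S N) h k + M * beta_mean (S N) h k)
      with (beta_mean (S N) (fun t => M * h t) k).
    - apply beta_mean_abs_le; auto; intros t.
      apply (continuous_scal_r (K := R_AbsRing) (V := R_NormedModule)); apply Hh.
    - rewrite beta_mean_scal by assumption; ring. }
  pose proof (binomial_mean_abs_le N x _ _ Hx (fun k _ => Hk k)) as H1.
  pose proof (binomial_mean_abs_le N x _ _ Hx (fun k _ => Hk (S k))) as H2.
  rewrite binomial_mean_linear in H1.
  rewrite (binomial_mean_linear N x 0 M (fun k => beta_mean (S N) h (S k))
     (fun k => beta_mean (S N) h (S k))) in H2.
  eapply Rle_trans; [apply Rabs_triang|]; rewrite !Rabs_mult.
  eapply Rle_trans.
  - apply Rplus_le_compat; apply Rmult_le_compat; try apply Rabs_pos; eassumption.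
  - lra.
Qed.

(** Under either compound law [t - x] has size at most of order [1 / sqrt n], in
    the mean of order 4, so [(t-x)^2] and [n (t-x)^4] both have mean of order
    [1 / n].  For the sum of the two laws the exact moments are polynomials in
    [n] and [y = x (1 - x)] over products of [n + i], and the higher powers of
    [n] in the numerators cancel. *)
Lemma second_fourth_moment_bound (N : nat) (x : R) : unit_interval x ->
  let n := INR (S N) in
  let h := fun t => (t - x) ^ 2 + n * (t - x) ^ 4 in
  binomial_mean N x (beta_mean (S N) h) + binomial_mean N x (fun k => beta_mean (S N) h (S k))
  <= 6 * / n.
Proof.
  intros [Hx0 Hx1]; cbv zeta.
  set (h := fun t => _).
  assert (Hn : 1 <= INR (S N)) by (rewrite S_INR; pose proof (pos_INR N); lra).
  assert (HN : INR N = INR (S N) - 1) by (rewrite S_INR; ring).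
  set (n := INR (S N)) in *.
  set (q1 := / (n + 2)). set (q2 := q1 * / (n + 3)).
  set (q3 := q2 * / (n + 4)). set (q4 := q3 * / (n + 5)).
  set (c0 := x ^ 2 + n * x ^ 4).
  set (c1 := (- 2 * x - 4 * n * x ^ 3) * q1).
  set (c2 := (1 + 6 * n * x ^ 2) * q2).
  set (c3 := - 4 * n * x * q3).
  set (c4 := n * q4).
  assert (Hbeta : forall k, (k <= S N)%nat -> beta_mean (S N) h k =
    c0 + c1 * (INR k + 1) + c2 * ((INR k + 1) * (INR k + 2))
    + c3 * ((INR k + 1) * (INR k + 2) * (INR k + 3))
    + c4 * ((INR k + 1) * (INR k + 2) * (INR k + 3) * (INR k + 4))).
  { intros k Hk.
    rewrite (beta_mean_ext _ _ h (fun t => c0 + (- 2 * x - 4 * n * x ^ 3) * t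
      + (1 + 6 * n * x ^ 2) * t ^ 2 + (- 4 * n * x) * t ^ 3 + n * t ^ 4))
      by (intros; unfold h, c0; ring).
    rewrite beta_mean_quartic by assumption; cbv zeta; fold n.
    unfold c1, c2, c3, c4, q4, q3, q2, q1; field; lra. }
  rewrite (binomial_mean_ext N x _ (fun k =>
    (c0 + c1 + 2 * c2 + 6 * c3 + 24 * c4) + (c1 + 3 * c2 + 11 * c3 + 50 * c4) * INR k
    + (c2 + 6 * c3 + 35 * c4) * INR k ^ 2 + (c3 + 10 * c4) * INR k ^ 3 + c4 * INR k ^ 4))
    by (intros; rewrite Hbeta by lia; ring).
  rewrite (binomial_mean_ext N x (fun k => beta_mean _ _ (S k)) (fun k =>
    (c0 + 2 * c1 + 6 * c2 + 24 * c3 + 120 * c4)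
    + (c1 + 5 * c2 + 26 * c3 + 154 * c4) * INR k
    + (c2 + 9 * c3 + 71 * c4) * INR k ^ 2 + (c3 + 14 * c4) * INR k ^ 3 + c4 * INR k ^ 4))
    by (intros; rewrite Hbeta, S_INR by lia; ring).
  rewrite !binomial_mean_quartic, HN.
  clearbody n.
  (* The sum of the two means is invariant under [x -> 1 - x], so it depends on
     [x] through [y] alone. *)
  set (y := x * (1 - x)).
  assert (Hy : 0 <= y <= 1 / 4).
  { unfold y; split; [apply Rmult_le_pos; lra | pose proof (pow2_ge_0 (x - 1/2)); lra]. }
  match goal with |- ?e <= _ => replace e with
    ((4 * (n - 7) * y + 8) / ((n + 2) * (n + 3))
     + n * (24 * n ^ 2 * y ^ 2 + n * (216 * y - 792 * y ^ 2) + 144 - 936 * y + 1488 * y ^ 2)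
       / ((n + 2) * (n + 3) * (n + 4) * (n + 5))) end.
  2: { unfold y, c0, c1, c2, c3, c4, q4, q3, q2, q1; field; lra. }
  clear - Hn Hy; clearbody y.
  (* The second moment accounts for [2 / n], the fourth for [4 / n]. *)
  replace (6 * / n) with (2 / n + 4 / n) by (field; lra).
  apply Rplus_le_compat.
  - apply Rle_div_l; [nra|].
    replace (2 / n * ((n + 2) * (n + 3))) with (2 * n + 10 + 12 / n) by (field; lra).
    assert (0 < 12 / n) by (apply Rdiv_lt_0_compat; lra). nra.
  - assert (0 < (n + 2) * (n + 3) * (n + 4) * (n + 5)).
    { repeat apply Rmult_lt_0_compat; lra. }
    apply Rle_div_l; [assumption|].
    replace (4 / n * ((n + 2) * (n + 3) * (n + 4) * (n + 5)))
      with (4 * n ^ 3 + 56 * n ^ 2 + 284 * n + 616 + 480 / n) by (field; lra).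
    assert (0 < 480 / n) by (apply Rdiv_lt_0_compat; lra).
    assert (0 <= y ^ 2 <= 1 / 16) by nra.
    assert (24 * n ^ 2 * y ^ 2 <= 4 * n ^ 2).
    { replace (24 * n ^ 2 * y ^ 2) with (24 * y ^ 2 * n ^ 2) by ring.
      apply Rmult_le_compat_r; [apply pow2_ge_0 | lra]. }
    assert (n * (216 * y - 792 * y ^ 2) <= 56 * n).
    { rewrite (Rmult_comm 56); apply Rmult_le_compat_l; lra. }
    assert (n * (24 * n ^ 2 * y ^ 2 + n * (216 * y - 792 * y ^ 2) + 144 - 936 * y + 1488 * y ^ 2)
      <= n * (4 * n ^ 2 + 56 * n + 284)) by (apply Rmult_le_compat_l; lra).
    lra.
Qed.

(** * Functions given on the unit interval *)

(** The retraction of the line onto [0,1].  Composing with it extends a function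
    known only on [0,1] to one that is continuous on the whole line, as the
    two-sided notions of continuity used by integrals and by the mean value
    theorem require at the endpoints. *)
Definition clamp (t : R) : R := Rmax 0 (Rmin 1 t).

Lemma clamp_unit_interval (t : R) : unit_interval (clamp t).
Proof.
  unfold clamp, unit_interval, Rmax, Rmin; repeat destruct Rle_dec; lra.
Qed.

Lemma clamp_id (t : R) : unit_interval t -> clamp t = t.
Proof.
  unfold clamp, unit_interval, Rmax, Rmin; repeat destruct Rle_dec; lra.
Qed.

Lemma clamp_contract (s t : R) : Rabs (clamp s - clamp t) <= Rabs (s - t).
Proof.
  unfold clamp, Rmax, Rmin, Rabs; repeat destruct Rle_dec; repeat destruct Rcase_abs; lra.
Qed.

Lemma continuous_clamp_extension (f : R -> R) (t : R) :
  (forall s, unit_interval s -> continue_in f unit_interval s) ->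
  continuous (fun s => f (clamp s)) t.
Proof.
  intros Hf; apply continuity_pt_filterlim.
  intros eps Heps.
  destruct (Hf (clamp t) (clamp_unit_interval t) eps Heps) as [d [Hd H]].
  exists d; split; [assumption|]; intros s [_ Hs].
  destruct (Req_dec (clamp s) (clamp t)) as [E|E].
  - rewrite E; simpl; rewrite R_dist_eq; assumption.
  - apply (H (clamp s)); split.
    + split; [apply clamp_unit_interval | auto].
    + simpl in *; eapply Rle_lt_trans; [apply clamp_contract | exact Hs].
Qed.

Lemma is_derive_clamp_extension (f f' : R -> R) (t : R) : 0 < t < 1 ->
  D_in f f' unit_interval t -> is_derive (fun s => f (clamp s)) t (f' t).
Proof.
  intros Ht H; apply is_derive_Reals; intros eps Heps.
  destruct (H eps Heps) as [d [Hd Hlim]].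
  assert (Hr : 0 < Rmin d (Rmin t (1 - t))) by (repeat apply Rmin_glb_lt; lra).
  exists (mkposreal _ Hr); simpl; intros s Hs0 Hs.
  assert (Hs1 : Rabs s < d) by (eapply Rlt_le_trans; [exact Hs | apply Rmin_l]).
  assert (Hs2 : Rabs s < t /\ Rabs s < 1 - t).
  { split; (eapply Rlt_le_trans; [exact Hs|]); (eapply Rle_trans; [apply Rmin_r|]);
    [apply Rmin_l | apply Rmin_r]. }
  assert (Hu : unit_interval (t + s)).
  { unfold unit_interval; destruct Hs2 as [Ha Hb]; revert Ha Hb;
    unfold Rabs; destruct Rcase_abs; lra. }
  rewrite !clamp_id by (try assumption; unfold unit_interval; lra).
  specialize (Hlim (t + s)); simpl in Hlim; unfold R_dist in Hlim.
  replace (t + s - t) with s in Hlim by ring.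
  apply Hlim; repeat split; try apply Hu; lra.
Qed.

Lemma mean_value_unit_interval (f f' : R -> R) (a b : R) :
  (forall s, unit_interval s -> D_in f f' unit_interval s) ->
  unit_interval a -> unit_interval b ->
  exists c, Rmin a b <= c <= Rmax a b /\ f b - f a = f' c * (b - a).
Proof.
  intros Hf Ha Hb.
  destruct (MVT_gen (fun s => f (clamp s)) a b f') as [c [Hc E]].
  - intros s Hs; apply is_derive_clamp_extension; [|apply Hf]; revert Hs;
      unfold unit_interval, Rmin, Rmax in *; destruct Rle_dec; lra.
  - intros s _; apply continuity_pt_filterlim, continuous_clamp_extension.
    intros r Hr; apply (cont_deriv f f' unit_interval), Hf, Hr.
  - exists c; split; [exact Hc|]; rewrite !clamp_id in E; assumption.
Qed.

Lemma is_derive_D_in (f f' : R -> R) (D : R -> Prop) (x : R) :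
  is_derive f x (f' x) -> D_in f f' D x.
Proof.
  intros H; apply is_derive_Reals in H; intros eps Heps.
  destruct (H eps Heps) as [d Hd].
  exists d; split; [apply cond_pos|]; intros s [[_ Hs] Hlt]; simpl in *.
  unfold R_dist in *.
  replace (f s) with (f (x + (s - x))) by (f_equal; ring).
  apply Hd; [lra | exact Hlt].
Qed.

(** The mean value theorem bounds the increment of [g1] minus its linear part,
    and applied again it bounds that of [g].  Integrating instead would gain a
    factor 1/2, which only affects the final constant. *)
Lemma taylor_remainder_bound (g g1 g2 : R -> R) (x t W : R) :
  C2_unit_interval g g1 g2 -> unit_interval x -> unit_interval t ->
  (forall s, unit_interval s -> Rabs (s - x) <= Rabs (t - x) -> Rabs (g2 s - g2 x) <= W) ->
  Rabs (g t - g x - g1 x * (t - x) - / 2 * g2 x * (t - x) ^ 2) <= (t - x) ^ 2 * W.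
Proof.
  intros Hg Hx Ht HW.
  assert (Hbetween : forall u s, unit_interval u -> Rmin x u <= s <= Rmax x u ->
    unit_interval s /\ Rabs (s - x) <= Rabs (u - x)).
  { intros u s Hu; revert Hx Hu; unfold unit_interval, Rmin, Rmax, Rabs.
    repeat destruct Rle_dec; repeat destruct Rcase_abs; lra. }
  assert (H1 : forall s, unit_interval s -> Rabs (s - x) <= Rabs (t - x) ->
    Rabs (g1 s - g1 x - g2 x * (s - x)) <= W * Rabs (t - x)).
  { intros s Hs Hst.
    destruct (mean_value_unit_interval g1 g2 x s) as [c [Hc E]]; try assumption.
    { intros r Hr; apply Hg, Hr. }
    destruct (Hbetween s c Hs Hc) as [Hc1 Hc2].
    replace (g1 s - g1 x - g2 x * (s - x)) with ((g2 c - g2 x) * (s - x)) by (rewrite E; ring).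
    rewrite Rabs_mult; apply Rmult_le_compat; try apply Rabs_pos; [|assumption].
    apply HW; [assumption | lra]. }
  destruct (mean_value_unit_interval
    (fun s => g s - (g1 x * s + / 2 * g2 x * (s - x) ^ 2))
    (fun s => g1 s - (g1 x + g2 x * (s - x))) x t) as [c [Hc E]]; try assumption.
  - intros s Hs; apply (Dminus unit_interval g1 (fun s => g1 x + g2 x * (s - x)) g
      (fun s => g1 x * s + / 2 * g2 x * (s - x) ^ 2)); [apply Hg, Hs|].
    apply is_derive_D_in; auto_derive; [trivial | unfold Rminus; field].
  - destruct (Hbetween t c Ht Hc) as [Hc1 Hc2].
    match goal with |- Rabs ?e <= _ =>
      replace e with ((g1 c - (g1 x + g2 x * (c - x))) * (t - x)) by (rewrite <- E; ring) end.
    replace (g1 c - (g1 x + g2 x * (c - x))) with (g1 c - g1 x - g2 x * (c - x)) by ring.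
    rewrite Rabs_mult, <- (pow2_abs (t - x)).
    replace (Rabs (t - x) ^ 2 * W) with (W * Rabs (t - x) * Rabs (t - x)) by ring.
    apply Rmult_le_compat_r; [apply Rabs_pos | apply H1; assumption].
Qed.

(** * The modulus of continuity *)

(** Continuity on the compact [0,1] bounds [h], so that the supremum is finite
    and [real] does not collapse it to 0. *)
Lemma modulus_continuity_bound (h : R -> R) (delta u v : R) :
  (forall s, unit_interval s -> continue_in h unit_interval s) ->
  unit_interval u -> unit_interval v -> Rabs (u - v) <= delta ->
  Rabs (h u - h v) <= modulus_continuity h delta.
Proof.
  intros Hh Hu Hv Huv.
  assert (Hc : forall c, continuity_pt (fun s => h (clamp s)) c)
    by (intros c; apply continuity_pt_filterlim, continuous_clamp_extension, Hh).
  destruct (continuity_ab_maj _ 0 1 Rle_0_1 (fun c _ => Hc c)) as [M [HM _]].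
  destruct (continuity_ab_min _ 0 1 Rle_0_1 (fun c _ => Hc c)) as [m [Hm _]].
  unfold modulus_continuity; set (E := fun y => _).
  assert (HE : E (Rabs (h u - h v))) by (exists u, v; repeat split; auto; apply Hu || apply Hv).
  destruct (Lub_Rbar_correct E) as [Hub Hlub].
  pose proof (Hub _ HE) as Hle.
  assert (Hfin : Rbar_le (Lub_Rbar E) (h (clamp M) - h (clamp m))).
  { apply Hlub; intros y [a [b [Ha [Hb [_ ->]]]]]; simpl.
    pose proof (HM a Ha); pose proof (HM b Hb); pose proof (Hm a Ha); pose proof (Hm b Hb).
    cbv beta in *; rewrite (clamp_id a Ha), (clamp_id b Hb) in *.
    apply Rabs_le; lra. }
  destruct (Lub_Rbar E); simpl in *; tauto.
Qed.

(** Cut the segment from [v] to [u] into [m + 1] pieces of length at most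
    [delta]; convexity of [0,1] keeps the intermediate points inside. *)
Lemma modulus_continuity_steps (h : R -> R) (delta : R) (m : nat) :
  (forall s, unit_interval s -> continue_in h unit_interval s) ->
  forall u v, unit_interval u -> unit_interval v -> Rabs (u - v) <= (INR m + 1) * delta ->
  Rabs (h u - h v) <= (INR m + 1) * modulus_continuity h delta.
Proof.
  intros Hh; induction m as [|m IH]; intros u v Hu Hv Huv.
  - simpl in *; rewrite Rplus_0_l, Rmult_1_l in *; apply modulus_continuity_bound; assumption.
  - rewrite S_INR in *; pose proof (pos_INR m) as Hm.
    set (w := v + (u - v) * / (INR m + 2)).
    assert (Hp : 0 < / (INR m + 2) <= 1).
    { split; [apply Rinv_0_lt_compat; lra|]. rewrite <- Rinv_1; apply Rinv_le_contravar; lra. }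
    assert (Hw : unit_interval w) by (unfold unit_interval, w in *; nra).
    replace (h u - h v) with ((h u - h w) + (h w - h v)) by ring.
    eapply Rle_trans; [apply Rabs_triang|].
    rewrite (Rmult_plus_distr_r (INR m + 1)), Rmult_1_l.
    apply Rplus_le_compat; [apply IH | apply modulus_continuity_bound]; try assumption.
    + replace (u - w) with ((INR m + 1) * / (INR m + 2) * (u - v)) by (unfold w; field; lra).
      rewrite Rabs_mult, Rabs_pos_eq by (apply Rmult_le_pos; lra).
      replace ((INR m + 1) * delta)
        with ((INR m + 1) * / (INR m + 2) * ((INR m + 1 + 1) * delta)) by (field; lra).
      apply Rmult_le_compat_l; [apply Rmult_le_pos; lra | assumption].
    + replace (w - v) with (/ (INR m + 2) * (u - v)) by (unfold w; ring).
      rewrite Rabs_mult, Rabs_pos_eq by lra.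
      replace delta with (/ (INR m + 2) * ((INR m + 1 + 1) * delta)) by (field; lra).
      apply Rmult_le_compat_l; lra.
Qed.

Lemma modulus_continuity_nonneg (h : R -> R) (delta : R) :
  (forall s, unit_interval s -> continue_in h unit_interval s) -> 0 <= delta ->
  0 <= modulus_continuity h delta.
Proof.
  intros Hh Hd; eapply Rle_trans; [apply (Rabs_pos (h 0 - h 0))|].
  apply modulus_continuity_bound; try (unfold unit_interval; lra); [assumption|].
  rewrite Rminus_diag, Rabs_R0; assumption.
Qed.

(** With [l = |u - v| / delta], the factor is 1 when [l <= 1] and at most
    [1 + l <= 1 + l^2] otherwise.  The square makes the bound polynomial in
    [u], which is what a moment estimate can use. *)
Lemma modulus_continuity_quadratic (h : R -> R) (delta u v : R) :
  (forall s, unit_interval s -> continue_in h unit_interval s) -> 0 < delta ->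
  unit_interval u -> unit_interval v ->
  Rabs (h u - h v) <= (1 + ((u - v) / delta) ^ 2) * modulus_continuity h delta.
Proof.
  intros Hh Hd Hu Hv.
  pose proof (modulus_continuity_nonneg h delta Hh (Rlt_le _ _ Hd)) as HW.
  set (l := Rabs (u - v) / delta).
  assert (Hl : 0 <= l).
  { apply Rmult_le_pos; [apply Rabs_pos | apply Rlt_le, Rinv_0_lt_compat, Hd]. }
  assert (El : Rabs (u - v) = l * delta) by (unfold l; field; lra).
  replace (((u - v) / delta) ^ 2) with (l ^ 2).
  2: { unfold l, Rdiv; rewrite !Rpow_mult_distr, pow2_abs; reflexivity. }
  destruct (Rle_dec l 1) as [H1|H1].
  - eapply Rle_trans; [apply (modulus_continuity_bound h delta); auto; nra|]. nra.
  - destruct (nfloor_ex l Hl) as [m Hm].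
    eapply Rle_trans.
    + apply (modulus_continuity_steps h delta m); auto.
      rewrite El; apply Rmult_le_compat_r; lra.
    + apply Rmult_le_compat_r; [assumption | nra].
Qed.

(** * The quantitative Voronovskaya estimate *)

Theorem theorem2p7 :
  exists C : R, 0 < C /\
    forall (g g1 g2 : R -> R), C2_unit_interval g g1 g2 ->
    forall (n : nat) (x : R), (1 <= n)%nat -> unit_interval x ->
      let D := durrmeyerM1 (fun _ => -3) (fun _ => 2) n in
      Rabs (D g x - g x - / 2 * D (fun t => (t - x) ^ 2) x * g2 x)
      <= C * / INR n * modulus_continuity g2 (/ sqrt (INR n)).
Proof.
  (* 12 = 2 * 6: the bound on [|2 - 3x|] times the moment constant. *)
  exists 12; split; [lra|]; intros g g1 g2 Hg n x Hn Hx; cbv zeta.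
  destruct n as [|N]; [lia|].
  assert (Hpos : 0 < INR (S N)) by (apply lt_0_INR; lia).
  pose proof (sqrt_lt_R0 _ Hpos) as Hsqrt.
  set (W := modulus_continuity g2 (/ sqrt (INR (S N)))).
  assert (HW : 0 <= W).
  { apply modulus_continuity_nonneg; [intros s Hs; apply Hg, Hs|].
    apply Rlt_le, Rinv_0_lt_compat, Hsqrt. }
  set (G := fun t => g (clamp t)).
  set (quad := fun t => (t - x) ^ 2).
  set (line := fun t => (g x - g1 x * x) + g1 x * t).
  set (remainder := fun t => (G t + -1 * line t) + (- (/ 2 * g2 x)) * quad t).
  set (h := fun t => (t - x) ^ 2 + INR (S N) * (t - x) ^ 4).
  assert (Gcont : forall t, continuous G t).
  { intros t; apply continuous_clamp_extension; intros s Hs.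
    apply (cont_deriv g g1 unit_interval), Hg, Hs. }
  assert (Hpoly : (forall t, continuous quad t) /\ (forall t, continuous line t)
    /\ (forall t, continuous h t)).
  { repeat split; intros t;
      apply (ex_derive_continuous (K := R_AbsRing) (V := R_NormedModule));
      unfold quad, line, h; auto_derive; auto. }
  destruct Hpoly as [Qcont [Lcont Hcont]].
  assert (GLcont : forall t, continuous (fun t => G t + -1 * line t) t).
  { intros t; apply (continuous_plus (V := R_NormedModule)); [apply Gcont|].
    apply (continuous_scal_r (V := R_NormedModule) (-1)), Lcont. }
  assert (Rcont : forall t, continuous remainder t).
  { intros t; apply (continuous_plus (V := R_NormedModule)); [apply GLcont|].
    apply (continuous_scal_r (V := R_NormedModule) (- (/ 2 * g2 x))), Qcont. }
  assert (Rem : forall t, unit_interval t -> Rabs (remainder t) <= W * h t).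
  { intros t Ht; unfold remainder, G, line, quad; rewrite clamp_id by assumption.
    replace (g t + -1 * (g x - g1 x * x + g1 x * t) + - (/ 2 * g2 x) * (t - x) ^ 2)
      with (g t - g x - g1 x * (t - x) - / 2 * g2 x * (t - x) ^ 2) by ring.
    replace (W * h t) with ((t - x) ^ 2 * ((1 + INR (S N) * (t - x) ^ 2) * W))
      by (unfold h; ring).
    apply (taylor_remainder_bound g g1 g2); try assumption.
    intros s Hs Hst.
    eapply Rle_trans.
    - apply (modulus_continuity_quadratic g2 (/ sqrt (INR (S N)))); try assumption.
      + intros r Hr; apply Hg, Hr.
      + apply Rinv_0_lt_compat, Hsqrt.
    - apply Rmult_le_compat_r; [assumption|].
      apply Rplus_le_compat_l; unfold Rdiv; rewrite Rinv_inv, Rpow_mult_distr.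
      rewrite pow2_sqrt, Rmult_comm by lra.
      apply Rmult_le_compat_l; [lra|].
      rewrite <- (pow2_abs (s - x)), <- (pow2_abs (t - x)).
      apply pow_incr; split; [apply Rabs_pos | assumption]. }
  replace (durrmeyerM1 (fun _ => -3) (fun _ => 2) (S N) g x - g x
    - / 2 * durrmeyerM1 (fun _ => -3) (fun _ => 2) (S N) quad x * g2 x)
    with (durrmeyerM1 (fun _ => -3) (fun _ => 2) (S N) remainder x).
  2: { unfold remainder; rewrite !durrmeyerM1_linear by assumption.
    unfold line at 1; rewrite durrmeyerM1_affine.
    rewrite (durrmeyerM1_ext _ _ _ G g); [ring|].
    intros t Ht; unfold G; rewrite clamp_id; [reflexivity | unfold unit_interval; lra]. }
  eapply Rle_trans.
  - apply (durrmeyerM1_abs_le _ _ 2 W N x remainder h); auto; unfold lin_coef;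
      destruct Hx; apply Rabs_le; lra.
  - pose proof (second_fourth_moment_bound N x Hx) as Hm; cbv zeta in Hm; fold h in Hm.
    replace (12 * / INR (S N) * W) with (2 * W * (6 * / INR (S N))) by ring.
    apply Rmult_le_compat_l; lra.
Qed.
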